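(* Let $R$ be a commutative ring and let $V$ be a finitely generated $\mathrm{FI}$-module over $R$ with $\deg(V)<\infty$. Then $\mathrm{reg}(V)=\deg(V)$.
   Context: Let $R$ be a commutative ring. $\mathrm{FI}$ denotes the category of finite sets and injective maps; an $\mathrm{FI}$-module is a covariant functor from $\mathrm{FI}$ to $R$-modules. For $n\in\mathbb{N}$, $[n]=\{1,\dots,n\}$. An $\mathrm{FI}$-module $V$ is finitely generated if there are finitely many elements $v_j\in V([n_j])$ such that every $V([n])$ is spanned over $R$ by the elements $\alpha(v_j)$ with $\alpha\in\mathrm{Hom}_{\mathrm{FI}}([n_j],[n])$. Let $A=\bigoplus_{0\le m\le n}A_{m,n}$, where $A_{m,n}$ is the free $R$-module on $\mathrm{Hom}_{\mathrm{FI}}([m],[n])$, with product $\alpha\beta=\alpha\circ\beta$ if composable and $0$ otherwise, and let $J=\bigoplus_{0\le m<n}A_{m,n}$. $\mathrm{FI}$-modules are identified with graded left $A$-modules via $V\mapsto\bigoplus_nV([n])$. The $\mathrm{FI}$-homology $H^{\mathrm{FI}}_a(V)=\mathrm{Tor}^A_a(A/J,V)$ is the $a$-th left derived functor of $V\mapsto V/JV$. The degree of an $\mathrm{FI}$-module $W$ is $\deg(W)=\sup\{n\in\mathbb{N}: W([n])\neq0\}$, with $\sup\emptyset=-\infty$. The Castelnuovo–Mumford regularity $\mathrm{reg}(V)$ is the infimum of the set of $c\in\mathbb{Z}$ such that $\deg(H^{\mathrm{FI}}_a(V))\le c+a$ for every $a\ge1$, with $\inf\emptyset=\infty$. *)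

(* Defs.v *)
From HB Require Import structures.
From mathcomp Require Import all_boot all_order all_algebra.
Set Implicit Arguments. Unset Strict Implicit. Unset Printing Implicit Defensive.
Import Order.TTheory GRing.Theory Num.Theory.
Local Open Scope ring_scope.

Definition Inj (m n : nat) := {f : {ffun 'I_m -> 'I_n} | injectiveb f}.

Lemma inj_comp_proof l m n (f : Inj m n) (g : Inj l m) :
  injectiveb [ffun i => val f (val g i)].
Proof.
have /injectiveP If := valP f; have /injectiveP Ig := valP g.
by apply/injectiveP => x y; rewrite !ffunE => /If /Ig.
Qed.

Definition inj_comp l m n (f : Inj m n) (g : Inj l m) : Inj l n :=
  exist (fun h : {ffun 'I_l -> 'I_n} => injectiveb h) _ (inj_comp_proof f g).

Lemma inj_id_proof n : injectiveb [ffun i : 'I_n => i].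
Proof. by apply/injectiveP => x y; rewrite !ffunE. Qed.

Definition inj_id n : Inj n n := exist (fun h : {ffun 'I_n -> 'I_n} => injectiveb h) _ (inj_id_proof n).

Record FIMod (R : comPzRingType) := {
  fmod : nat -> lmodType R;
  fmap : forall m n, Inj m n -> {linear fmod m -> fmod n};
  fmap_id : forall n (x : fmod n), fmap (inj_id n) x = x;
  fmap_comp : forall l m n (f : Inj m n) (g : Inj l m) (x : fmod l),
      fmap (inj_comp f g) x = fmap f (fmap g x)
}.

Record FIHom (R : comPzRingType) (V W : FIMod R) := {
  hmap : forall n, {linear fmod V n -> fmod W n};
  hnat : forall m n (f : Inj m n) (x : fmod V m),
      hmap n (fmap V f x) = fmap W f (hmap m x)
}.

Inductive inspan (R : comPzRingType) (M : lmodType R) (S : M -> Prop) : M -> Prop :=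
| inspan0 : inspan S 0
| inspan_gen x : S x -> inspan S x
| inspanD x y : inspan S x -> inspan S y -> inspan S (x + y)
| inspanZ (a : R) x : inspan S x -> inspan S (a *: x).

Definition fin_gen (R : comPzRingType) (V : FIMod R) : Prop :=
  exists s : seq {m : nat & fmod V m},
    forall n (x : fmod V n),
      inspan (fun y => exists v, v \in s /\
                exists a : Inj (tag v) n, y = fmap V a (tagged v)) x.

Definition inJ (R : comPzRingType) (V : FIMod R) (n : nat) (x : fmod V n) : Prop :=
  inspan (fun y => exists m (a : Inj m n) (z : fmod V m), (m < n)%N /\ y = fmap V a z) x.

(* Degree: deg W = d, with d = None standing for -infinity. *)
Definition deg_is (R : comPzRingType) (W : FIMod R) (d : option nat) : Prop :=
  match d with
  | None => forall n (x : fmod W n), x = 0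
  | Some k => (exists x : fmod W k, x != 0) /\
              (forall n (x : fmod W n), (k < n)%N -> x = 0)
  end.

Definition projective (R : comPzRingType) (P : FIMod R) : Prop :=
  forall (M N : FIMod R) (p : FIHom M N) (g : FIHom P N),
    (forall n (y : fmod N n), exists x, hmap p n x = y) ->
    exists h : FIHom P M, forall n (x : fmod P n), hmap p n (hmap h n x) = hmap g n x.

Record Resolution (R : comPzRingType) (V : FIMod R) := {
  rP : nat -> FIMod R;
  rd : forall k, FIHom (rP k.+1) (rP k);
  reps : FIHom (rP 0) V;
  rproj : forall k, projective (rP k);
  reps_surj : forall n (y : fmod V n), exists x, hmap reps n x = y;
  rcomp0 : forall n (y : fmod (rP 1) n), hmap reps n (hmap (rd 0) n y) = 0;
  rexact0 : forall n (x : fmod (rP 0) n),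
      hmap reps n x = 0 -> exists y, hmap (rd 0) n y = x;
  rcomp : forall k n (y : fmod (rP k.+2) n), hmap (rd k) n (hmap (rd k.+1) n y) = 0;
  rexact : forall k n (x : fmod (rP k.+1) n),
      hmap (rd k) n x = 0 -> exists y, hmap (rd k.+1) n y = x
}.

(* FI-homology computed from a resolution:
   H_a(V) = homology at P_a of the complex P_* / J P_*.
   H_{a'.+1}(V)([n]) <> 0  iff  there is a cycle modulo J that is not a
   boundary modulo J. *)
Definition FIH_nonzero (R : comPzRingType) (V : FIMod R) (res : Resolution V)
    (a' n : nat) : Prop :=
  exists x : fmod (rP res a'.+1) n,
    inJ (hmap (rd res a') n x) /\
    ~ (exists (y : fmod (rP res a'.+2) n) (z : fmod (rP res a'.+1) n),
          inJ z /\ x = hmap (rd res a'.+1) n y + z).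

Definition reg_adm (R : comPzRingType) (V : FIMod R) (res : Resolution V) (c : int) : Prop :=
  forall a' n, FIH_nonzero res a' n -> (n%:Z <= c + (a'.+1)%:Z)%R.

(* reg(V) = r, with r = None standing for -infinity (inf over Z). *)
Definition reg_is (R : comPzRingType) (V : FIMod R) (res : Resolution V) (r : option int) : Prop :=
  match r with
  | None => forall b : int, exists c, (c <= b)%R /\ reg_adm res c
  | Some k => reg_adm res k /\ forall c, reg_adm res c -> (k <= c)%R
  end.

(* Main.v *)
Require Import Defs.
From HB Require Import structures.
From mathcomp Require Import all_boot all_order all_algebra perm.
From mathcomp Require Import finmap zify.
From Stdlib Require Import Classical.
Set Implicit Arguments. Unset Strict Implicit. Unset Printing Implicit Defensive.
Import Order.TTheory GRing.Theory Num.Theory.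
Local Open Scope ring_scope.

(* The FI-homology of [V] in degree [n] is computed by a Koszul complex [K n]:
   its [q]-th term is a sum of ['C(n, q)] copies of [V_(n-q)], it is an exact
   functor of [V], it is acyclic in positive degrees when [V] is projective, and
   its [0]-th homology is [(V / J V)_n].  Balancing it against a projective
   resolution in a double complex identifies [H_a(V)_n] with [H_a(K n V)].  Let
   [d] be the degree of [V].  If [n > d + a], the [a]-th term vanishes.  If
   [n = d + a], the [(a-1)]-st term vanishes, while the [a]-th and [(a+1)]-st
   are ['C(d + a, a)] copies of [V_d] and ['C(d + a, a + 1)] copies of
   [V_(d-1)]; since the ratio of the two binomials is [(a + 1) / d], for [a]
   large the differential between them cannot be onto. *)

(** * Free modules *)

Section FreeModule.
Variables (R : comPzRingType) (X : choiceType).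

Definition freemod := {fsfun X -> R with 0}.
HB.instance Definition _ := Choice.on freemod.

Implicit Types u v w : freemod.

Definition free_comb (a : R) u v : freemod :=
  [fsfun x in (finsupp u `|` finsupp v)%fset => a * u x + v x].

Lemma free_combE a u v x : free_comb a u v x = a * u x + v x.
Proof.
rewrite fsfunE in_fsetU; case: ifPn => //.
by rewrite negb_or !memNfinsupp => /andP[/eqP -> /eqP ->]; rewrite mulr0 addr0.
Qed.

Definition free0 : freemod := [fsfun].
Definition free_opp u := free_comb (-1) u free0.
Definition free_add := free_comb 1.
Definition free_scale a u := free_comb a u free0.

Lemma free_addA : associative free_add.
Proof.
by move=> u v w; apply/fsfunP => x; rewrite !free_combE !mul1r addrA.
Qed.

Lemma free_addC : commutative free_add.
Proof.
by move=> u v; apply/fsfunP => x; rewrite !free_combE !mul1r addrC.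
Qed.

Lemma free_add0 : left_id free0 free_add.
Proof.
by move=> u; apply/fsfunP => x; rewrite free_combE fsfunE mulr0 add0r.
Qed.

Lemma free_addN : left_inverse free0 free_opp free_add.
Proof.
move=> u; apply/fsfunP => x.
by rewrite !free_combE fsfunE mul1r addr0 mulN1r addNr.
Qed.

HB.instance Definition _ :=
  GRing.isZmodule.Build freemod free_addA free_addC free_add0 free_addN.

Lemma free_addE u v x : (u + v) x = u x + v x.
Proof. by rewrite free_combE mul1r. Qed.

Lemma free_scaleE a u x : free_scale a u x = a * u x.
Proof. by rewrite free_combE fsfunE addr0. Qed.

Lemma free_scaleA a b u : free_scale a (free_scale b u) = free_scale (a * b) u.
Proof. by apply/fsfunP => x; rewrite !free_scaleE mulrA. Qed.

Lemma free_scale1 : left_id 1 free_scale.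
Proof. by move=> u; apply/fsfunP => x; rewrite free_scaleE mul1r. Qed.

Lemma free_scaleDr : right_distributive free_scale +%R.
Proof.
move=> a u v; apply/fsfunP => x.
by rewrite free_addE !free_scaleE free_addE mulrDr.
Qed.

Lemma free_scaleDl u : {morph free_scale^~ u : a b / a + b}.
Proof.
move=> a b; apply/fsfunP => x.
by rewrite free_addE !free_scaleE mulrDl.
Qed.

HB.instance Definition _ := GRing.Zmodule_isLmodule.Build R freemod
  free_scaleA free_scale1 free_scaleDr free_scaleDl.

Lemma free_linE a u v x : (a *: u + v) x = a * u x + v x.
Proof. by rewrite free_addE; congr (_ + _); exact: free_scaleE. Qed.

Definition bas (x : X) : freemod := [fsfun y in [fset x]%fset => 1].

Lemma basE x y : bas x y = (y == x)%:R.
Proof. by rewrite fsfunE in_fset1; case: eqP. Qed.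

Section Lift.
Variables (M : lmodType R) (g : X -> M).

Definition lift_fun u : M := \sum_(x <- finsupp u) u x *: g x.

Lemma lift_fun_incl (A : {fset X}) u : (finsupp u `<=` A)%fset ->
  lift_fun u = \sum_(x <- A) u x *: g x.
Proof.
move=> sA; apply: big_fset_incl => // x _.
by rewrite memNfinsupp => /eqP ->; rewrite scale0r.
Qed.

Lemma lift_fun_lin : linear lift_fun.
Proof.
move=> a u v; pose w : freemod := a *: u + v.
pose A := (finsupp w `|` (finsupp (u : freemod) `|` finsupp (v : freemod)))%fset.
rewrite -/w (@lift_fun_incl A w); last exact: fsubsetUl.
rewrite (@lift_fun_incl A u); last by rewrite fsubsetU // fsubsetUl orbT.
rewrite (@lift_fun_incl A v); last by rewrite fsubsetU // fsubsetUr orbT.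
rewrite scaler_sumr -big_split; apply: eq_bigr => x _ /=.
by rewrite free_linE scalerDl scalerA.
Qed.

HB.instance Definition _ := GRing.isLinear.Build R freemod M *:%R lift_fun lift_fun_lin.

Definition lift_free : {linear freemod -> M} := lift_fun.

Lemma lift_bas x : lift_free (bas x) = g x.
Proof.
rewrite /= (@lift_fun_incl [fset x]%fset).
  by rewrite big_seq_fset1 basE eqxx scale1r.
by apply: finsupp_sub.
Qed.
End Lift.

Lemma free_ext (M : lmodType R) (f g : {linear freemod -> M}) :
  (forall x, f (bas x) = g (bas x)) -> f =1 g.
Proof.
move=> fg u.
have -> : u = \sum_(x <- finsupp u) u x *: bas x.
  apply/fsfunP => y.
  have sumE (s : seq X) (c : X -> R) :
      (\sum_(x <- s) c x *: bas x) y = \sum_(x <- s) c x * (y == x)%:R.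
    elim: s => [|x s IHs]; first by rewrite !big_nil fsfunE.
    by rewrite !big_cons free_linE IHs basE.
  rewrite sumE; have [yu|yu] := boolP (y \in finsupp u).
    rewrite (big_fsetD1 y) //= eqxx mulr1 big1_fset ?addr0 // => x.
    by rewrite in_fsetD1 eq_sym => /andP[/negPf -> _]; rewrite mulr0.
  have /eqP -> : u y == 0 by rewrite -memNfinsupp.
  rewrite big_seq big1 // => x xu; case: eqP => [yx|]; last by rewrite mulr0.
  by rewrite yx xu in yu.
by rewrite !linear_sum; apply: eq_bigr => x _; rewrite !linearZ fg.
Qed.
End FreeModule.

(** * FI-modules that extend to partial maps *)

Lemma inj_eqP m n (f g : Inj m n) : (forall i, val f i = val g i) <-> f = g.
Proof. by split=> [fg|-> //]; apply: val_inj; apply/ffunP. Qed.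

Lemma val_injective m n (f : Inj m n) : injective (val f).
Proof. exact/injectiveP/(valP f). Qed.

Definition mk_inj m n (f : 'I_m -> 'I_n) (If : injective f) : Inj m n.
Proof.
by exists (finfun f); apply/injectiveP => x y; rewrite !ffunE => /If.
Defined.

Lemma mk_injE m n (f : 'I_m -> 'I_n) (If : injective f) i :
  val (mk_inj If) i = f i.
Proof. by rewrite /= ffunE. Qed.

Definition lift0 m n (f : 'I_m -> 'I_n) (i : 'I_m.+1) : 'I_n.+1 :=
  if unlift ord0 i is Some j then lift ord0 (f j) else ord0.

Lemma lift0_ord0 m n (f : 'I_m -> 'I_n) : lift0 f ord0 = ord0.
Proof. by rewrite /lift0 unlift_none. Qed.

Lemma lift0_lift m n (f : 'I_m -> 'I_n) i : lift0 f (lift ord0 i) = lift ord0 (f i).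
Proof. by rewrite /lift0 liftK. Qed.

Lemma lift0_inj m n (f : 'I_m -> 'I_n) : injective f -> injective (lift0 f).
Proof.
move=> If x y; case: (unliftP ord0 x) (unliftP ord0 y) => [i ->|->] [j ->|->] //;
  rewrite ?lift0_lift ?lift0_ord0.
- by move=> /lift_inj/If ->.
- by move=> /eqP; rewrite eq_sym (negPf (neq_lift _ _)).
- by move=> /eqP; rewrite (negPf (neq_lift _ _)).
Qed.

Definition inj_lift m n (f : Inj m n) : Inj m.+1 n.+1 :=
  mk_inj (lift0_inj (@val_injective m n f)).

Definition inj_shift n : Inj n n.+1 := mk_inj (@lift_inj n.+1 ord0).

Lemma inj_lift_shift m n (f : Inj m n) :
  Defs.inj_comp (inj_lift f) (inj_shift m) = Defs.inj_comp (inj_shift n) f.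
Proof. by apply/inj_eqP => i /=; rewrite !ffunE lift0_lift. Qed.

Lemma inj_lift_id n : inj_lift (Defs.inj_id n) = Defs.inj_id n.+1.
Proof.
apply/inj_eqP => i /=; rewrite !ffunE.
by case: (unliftP ord0 i) => [j ->|->]; rewrite ?lift0_lift ?lift0_ord0 /= ?ffunE.
Qed.

Lemma inj_lift_comp l m n (f : Inj m n) (g : Inj l m) :
  inj_lift (Defs.inj_comp f g) = Defs.inj_comp (inj_lift f) (inj_lift g).
Proof.
apply/inj_eqP => i /=; rewrite !ffunE.
case: (unliftP ord0 i) => [j ->|->]; last by rewrite !lift0_ord0.
by rewrite !lift0_lift /= ?ffunE.
Qed.

(** Partial maps enter because [V -> FIshift V] is to be retracted along [pdrop], which is undefined
    at the first point and undoes the shift elsewhere; no injection does this. *)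
Definition pf m n := {ffun 'I_m -> option 'I_n}.
Definition pcomp l m n (p : pf m n) (q : pf l m) : pf l n :=
  [ffun i => obind p (q i)].
Definition ptot m n (f : Inj m n) : pf m n := [ffun i => Some (val f i)].
Definition plift m n (p : pf m n) : pf m.+1 n.+1 :=
  [ffun i => if unlift ord0 i is Some j then omap (lift ord0) (p j) else Some ord0].
Definition pdrop n : pf n.+1 n := [ffun i => unlift ord0 i].

Lemma pcompA k l m n (p : pf m n) (q : pf l m) (r : pf k l) :
  pcomp (pcomp p q) r = pcomp p (pcomp q r).
Proof. by apply/ffunP => i; rewrite !ffunE; case: (r i) => //= j; rewrite ffunE. Qed.

Lemma ptot_comp l m n (f : Inj m n) (g : Inj l m) :
  ptot (Defs.inj_comp f g) = pcomp (ptot f) (ptot g).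
Proof. by apply/ffunP => i; rewrite !ffunE /= !ffunE. Qed.

Lemma ptot_inj m n : injective (@ptot m n).
Proof.
move=> f g /ffunP fg; apply/inj_eqP => i.
by have := fg i; rewrite !ffunE => -[].
Qed.

(** A point where [q] is undefined, or two points that it identifies, would remain so after [p].
    Hence discarding the composites that are not total injections respects composition, as
    [inj_of_comp] records. *)
Lemma pcomp_tot l m n (p : pf m n) (q : pf l m) (f : Inj l n) :
  pcomp p q = ptot f -> exists g, q = ptot g.
Proof.
move=> /ffunP pq.
have tot i : exists j, q i = Some j.
  by have := pq i; rewrite !ffunE; case: (q i) => //= j; exists j.
have [g gP] := fin_all_exists tot.
have Ig : injective g.
  move=> x y gxy; apply: (@val_injective _ _ f).
  have := pq x; have := pq y; rewrite !ffunE !gP gxy /= => -> [].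
  by move=> ->.
by exists (mk_inj Ig); apply/ffunP => i; rewrite ffunE gP mk_injE.
Qed.

Lemma plift_comp l m n (p : pf m n) (q : pf l m) :
  plift (pcomp p q) = pcomp (plift p) (plift q).
Proof.
apply/ffunP => i; rewrite !ffunE; case: (unliftP ord0 i) => [j _|_] /=.
  rewrite ffunE; case: (q j) => //= k.
  by rewrite ffunE liftK.
by rewrite ffunE unlift_none.
Qed.

Lemma plift_tot m n (f : Inj m n) : plift (ptot f) = ptot (inj_lift f).
Proof.
apply/ffunP => i; rewrite !ffunE /= /lift0; case: (unlift ord0 i) => // j.
by rewrite ffunE.
Qed.

Lemma pdrop_shift n : pcomp (pdrop n) (ptot (inj_shift n)) = ptot (Defs.inj_id n).
Proof. by apply/ffunP => i; rewrite !ffunE /= !ffunE liftK. Qed.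

Lemma pdrop_lift m n (f : Inj m n) :
  pcomp (pdrop n) (ptot (inj_lift f)) = pcomp (ptot f) (pdrop m).
Proof.
apply/ffunP => i; rewrite !ffunE /= !ffunE /lift0.
by case: (unliftP ord0 i) => [j _|_] /=; rewrite ?liftK ?unlift_none ?ffunE.
Qed.

Definition inj_of m n (h : pf m n) : option (Inj m n) := [pick f | ptot f == h].

Lemma inj_of_tot m n (f : Inj m n) : inj_of (ptot f) = Some f.
Proof.
rewrite /inj_of; case: pickP => [g /eqP/ptot_inj -> //|/(_ f)].
by rewrite eqxx.
Qed.

Lemma inj_of_comp l m n (p : pf m n) (q : pf l m) :
  inj_of (pcomp p q) = obind (fun f => inj_of (pcomp p (ptot f))) (inj_of q).
Proof.
case: (pickP (fun f => ptot f == q)) => [g /eqP <-|noq].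
  by rewrite inj_of_tot.
have -> : inj_of q = None by rewrite /inj_of; case: pickP => // g; rewrite noq.
rewrite /inj_of; case: pickP => // f /eqP/esym/pcomp_tot[g qg].
by have := noq g; rewrite qg eqxx.
Qed.

Section Shift.
Variable R : comPzRingType.
Implicit Types V W : FIMod R.

Definition FIshift V : FIMod R.
Proof.
exists (fun n => fmod V n.+1) (fun m n f => fmap V (inj_lift f)).
- by move=> n x; rewrite inj_lift_id fmap_id.
- by move=> l m n f g x; rewrite inj_lift_comp fmap_comp.
Defined.

Definition FIshift_hom V W (phi : FIHom V W) : FIHom (FIshift V) (FIshift W).
Proof.
exists (fun n => hmap phi n.+1).
by move=> m n f x; exact: (hnat phi (inj_lift f)).
Defined.

Definition to_shift V : FIHom V (FIshift V).
Proof.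
exists (fun n => fmap V (inj_shift n)).
by move=> m n f x; rewrite /= -!fmap_comp inj_lift_shift.
Defined.

Definition comp_hom U V W (g : FIHom V W) (f : FIHom U V) : FIHom U W.
Proof.
exists (fun n => hmap g n \o hmap f n)%FUN.
by move=> m n a x; rewrite /= !hnat.
Defined.

(* What the Koszul complex needs from projectivity: such a structure is inherited
   by [FIshift V] and provides a natural retraction of [to_shift V]. *)
Record sharp V := {
  smap : forall m n, pf m n -> {linear fmod V m -> fmod V n};
  smap_comp : forall l m n (p : pf m n) (q : pf l m) x,
    smap (pcomp p q) x = smap p (smap q x);
  smap_tot : forall m n (f : Inj m n) x, smap (ptot f) x = fmap V f x }.

Definition sharp_shift V : sharp V -> sharp (FIshift V).
Proof.
move=> s; exists (fun m n p => smap s (plift p)).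
- by move=> l m n p q x; rewrite plift_comp smap_comp.
- by move=> m n f x; rewrite plift_tot smap_tot.
Defined.

Definition sharp_retract V (s : sharp V) : FIHom (FIshift V) V.
Proof.
exists (fun n => smap s (pdrop n)).
by move=> m n f x /=; rewrite -!(smap_tot s) -!smap_comp pdrop_lift.
Defined.

Lemma sharp_retractK V (s : sharp V) n x :
  hmap (sharp_retract s) n (hmap (to_shift V) n x) = x.
Proof.
by rewrite /= -(smap_tot s) -smap_comp pdrop_shift smap_tot fmap_id.
Qed.

End Shift.

Section FreeFI.
Variables (R : comPzRingType) (S : nat -> choiceType).

(** The degree [n] basis of a direct sum of representables [Hom([m], -)], one for each element of
    [S m]. *)
Definition gens n : choiceType := {m : nat & (S m * Inj m n)%type}.

Definition gen m n (s : S m) (f : Inj m n) : gens n :=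
  Tagged (fun m => (S m * Inj m n)%type) (s, f).

(* A partial map sends an injection to [None] unless the composite is a total
   injection; this stays functorial even though partial maps need not be
   injective. *)
Definition gact m n (p : pf m n) (x : gens m) : option (gens n) :=
  omap (gen (tagged x).1) (inj_of (pcomp p (ptot (tagged x).2))).

Definition fact_map m n (p : pf m n) : {linear freemod R (gens m) -> freemod R (gens n)} :=
  lift_free (fun x => if gact p x is Some y then bas R y else 0).

Lemma fact_comp l m n (p : pf m n) (q : pf l m) x :
  fact_map (pcomp p q) x = fact_map p (fact_map q x).
Proof.
apply: (free_ext (g := fact_map p \o fact_map q)) => {}x.
rewrite /= !lift_bas /gact pcompA inj_of_comp.
case: (inj_of _) => [f|] /=; last by rewrite linear0.
by rewrite lift_bas /gact.
Qed.

Lemma fact_tot_gen k m n (f : Inj m n) (s : S k) (g : Inj k m) :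
  fact_map (ptot f) (bas R (gen s g)) = bas R (gen s (Defs.inj_comp f g)).
Proof. by rewrite lift_bas /gact /= -ptot_comp inj_of_tot. Qed.

Definition freeFI : FIMod R.
Proof.
exists (fun n => freemod R (gens n) : lmodType R) (fun m n f => fact_map (ptot f)).
- move=> n x; apply: (free_ext (g := idfun)) => -[k [s g]].
  rewrite [existT _ _ _]/(gen s g) fact_tot_gen /=; congr (bas R (gen s _)).
  by apply/inj_eqP => i; rewrite /= !ffunE.
- by move=> l m n f g x; rewrite ptot_comp fact_comp.
Defined.

Definition freeFI_sharp : sharp freeFI.
Proof. by exists fact_map; [exact: fact_comp|]. Defined.

Definition fgen m (s : S m) : fmod freeFI m := bas R (gen s (Defs.inj_id m)).

Section Hom.
Variables (V : FIMod R) (phi : forall m, S m -> fmod V m).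

Definition free_hom_map n : {linear fmod freeFI n -> fmod V n} :=
  lift_free (fun x : gens n => fmap V (tagged x).2 (phi (tagged x).1)).

Definition free_hom : FIHom freeFI V.
Proof.
exists free_hom_map => m n f x.
apply: (free_ext (f := free_hom_map n \o fmap freeFI f)
  (g := fmap V f \o free_hom_map m)) => -[k [s g]].
rewrite [existT _ _ _]/(gen s g) /= fact_tot_gen /= !lift_bas /=.
by rewrite fmap_comp.
Defined.

Lemma free_homE m (s : S m) : hmap free_hom m (fgen s) = phi s.
Proof. by rewrite /= lift_bas fmap_id. Qed.
End Hom.

Lemma free_hom_ext (V : FIMod R) (f g : FIHom freeFI V) :
  (forall m (s : S m), hmap f m (fgen s) = hmap g m (fgen s)) ->
  forall n x, hmap f n x = hmap g n x.
Proof.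
move=> fg n; apply: free_ext => -[k [s a]].
rewrite [existT _ _ _]/(gen s a).
have -> : bas R (gen s a) = fmap freeFI a (fgen s).
  rewrite /= fact_tot_gen; congr (bas R (gen s _)).
  by apply/inj_eqP => i; rewrite /= !ffunE.
by rewrite !hnat fg.
Qed.

Lemma free_projective : projective freeFI.
Proof.
move=> M N p g surj.
have surj' m (s : S m) : exists x, hmap p m x == hmap g m (fgen s).
  by have [x <-] := surj m (hmap g m (fgen s)); exists x.
exists (free_hom (fun m s => xchoose (surj' m s))).
apply: (free_hom_ext (f := comp_hom p (free_hom _))) => m s.
exact: etrans (congr1 (hmap p m) (free_homE _ s)) (eqP (xchooseP (surj' m s))).
Qed.

End FreeFI.

(** * Free resolutions *)

Section FreeResolution.
Variable R : comPzRingType.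

Definition free_cover (V : FIMod R) : FIHom (freeFI R (fmod V)) V :=
  free_hom (fun m (s : fmod V m) => s).

Lemma free_cover_surj (V : FIMod R) n (y : fmod V n) :
  exists x, hmap (free_cover V) n x = y.
Proof. by exists (fgen R (S := fmod V) y); rewrite free_homE. Qed.

(** Lifting the identity along the free cover splits it. Koszul acyclicity passes from free to
    projective modules along this splitting. *)
Lemma projective_retract (P : FIMod R) : projective P ->
  exists i : FIHom P (freeFI R (fmod P)),
    forall n x, hmap (free_cover P) n (hmap i n x) = x.
Proof.
move=> projP; pose id_hom := Build_FIHom
  (hmap := fun n => idfun : {linear fmod P n -> fmod P n})
  (fun m n f x => erefl _).
exact: (projP _ _ (free_cover P) id_hom (@free_cover_surj P)).
Qed.

Section Kernel.
Variables (P Q : FIMod R) (phi : FIHom P Q).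

Definition ker_gens n : choiceType := {x : fmod P n | hmap phi n x == 0}.

Definition ker_cover : FIHom (freeFI R ker_gens) P :=
  free_hom (fun m (s : ker_gens m) => val s).

Lemma ker_cover0 n x : hmap phi n (hmap ker_cover n x) = 0.
Proof.
pose zero_hom := Build_FIHom (V := freeFI R ker_gens) (W := Q)
  (hmap := fun n => \0 : {linear _ -> fmod Q n})
  (fun m n f x => esym (linear0 (fmap Q f))).
apply: (free_hom_ext (f := comp_hom phi ker_cover) (g := zero_hom)) => m s.
exact: etrans (congr1 (hmap phi m) (free_homE _ s)) (eqP (valP s)).
Qed.

Lemma ker_cover_exact n x : hmap phi n x = 0 -> exists y, hmap ker_cover n y = x.
Proof.
move=> /eqP x0; exists (fgen R (S := ker_gens) (Sub x x0)).
by rewrite free_homE.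
Qed.
End Kernel.

(** One type for all stages of a resolution, so that it can be built with [iter]; the target of
    [next_arrow s] is by computation the source of [s]. *)
Record arrow := Arrow {
  asrc : FIMod R;
  atgt : FIMod R;
  ahom : FIHom asrc atgt;
  aproj : projective asrc }.

Definition next_arrow (s : arrow) : arrow :=
  Arrow (ker_cover (ahom s)) (@free_projective R _).

Definition free_resolution (V : FIMod R) : Resolution V.
Proof.
pose s0 := Arrow (free_cover V) (@free_projective R _).
exists (fun k => asrc (iter k next_arrow s0))
       (fun k => ahom (iter k.+1 next_arrow s0)) (ahom s0).
- by move=> k; exact: aproj.
- exact: free_cover_surj.
- exact: (@ker_cover0 _ _ (free_cover V)).
- exact: (@ker_cover_exact _ _ (free_cover V)).
- by move=> k; exact: (@ker_cover0 _ _ (ahom (iter k.+1 next_arrow s0))).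
- by move=> k; exact: (@ker_cover_exact _ _ (ahom (iter k.+1 next_arrow s0))).
Defined.
End FreeResolution.

(** * The Koszul complex *)

Section Koszul.
Variable R : comPzRingType.
Implicit Types V W U : FIMod R.

(* [K n q V] stands for the sum of [V([n] \ T)] over the [q]-element subsets [T]
   of [n].  Splitting according to whether [T] contains the first point makes the
   complex for [n.+1] the mapping cone of [K n V -> K n (FIshift V)]. *)
Fixpoint K n q V : lmodType R :=
  match n, q with
  | 0, 0 => fmod V 0
  | 0, _.+1 => 'rV[R]_0
  | n.+1, 0 => K n 0 (FIshift V)
  | n.+1, q.+1 => (K n q.+1 (FIshift V) * K n q V)%type
  end.

Fixpoint Kmap n q V W (phi : FIHom V W) {struct n} : K n q V -> K n q W :=
  match n, q return K n q V -> K n q W with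
  | 0, 0 => hmap phi 0
  | 0, _.+1 => id
  | n.+1, 0 => @Kmap n 0 _ _ (FIshift_hom phi)
  | n.+1, q.+1 => fun x => (@Kmap n q.+1 _ _ (FIshift_hom phi) x.1, @Kmap n q _ _ phi x.2)
  end.
Arguments Kmap n q {V W} phi.

Lemma Kmap_linear n q V W (phi : FIHom V W) : linear (Kmap n q phi).
Proof.
elim: n q V W phi => [|n IHn] [|q] V W phi a x y /=.
- exact: linearP.
- by [].
- exact: IHn.
- by congr (_, _); exact: IHn.
Qed.

HB.instance Definition _ n q V W (phi : FIHom V W) :=
  GRing.isLinear.Build R (K n q V) (K n q W) *:%R (Kmap n q phi) (@Kmap_linear n q V W phi).

(** Functoriality, stated for squares that commute pointwise, so that morphisms are never compared
    as records. *)
Lemma Kmap_square n q V V1 V2 W (f1 : FIHom V V1) (f2 : FIHom V V2)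
    (g1 : FIHom V1 W) (g2 : FIHom V2 W) :
  (forall m x, hmap g1 m (hmap f1 m x) = hmap g2 m (hmap f2 m x)) ->
  forall x, Kmap n q g1 (Kmap n q f1 x) = Kmap n q g2 (Kmap n q f2 x).
Proof.
elim: n q V V1 V2 W f1 f2 g1 g2 => [|n IHn] [|q] V V1 V2 W f1 f2 g1 g2 fg x //=.
- exact: fg.
- by apply: IHn => m y; exact: fg.
- by congr (_, _); apply: IHn => m y; exact: fg.
Qed.

Lemma Kmap_retract n q V W (f : FIHom V W) (g : FIHom W V) :
  (forall m x, hmap g m (hmap f m x) = x) ->
  forall x, Kmap n q g (Kmap n q f x) = x.
Proof.
elim: n q V W f g => [|n IHn] [|q] V W f g gf x //=.
- exact: gf.
- by apply: IHn => m y; exact: gf.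
- by case: x => x y; congr (_, _); apply: IHn => m z; exact: gf.
Qed.

Lemma Kmap_comp0 n q V W U (f : FIHom V W) (g : FIHom W U) :
  (forall m x, hmap g m (hmap f m x) = 0) ->
  forall x, Kmap n q g (Kmap n q f x) = 0.
Proof.
elim: n q V W U f g => [|n IHn] [|q] V W U f g gf x /=.
- exact: gf.
- by apply/rowP => -[].
- by apply: IHn => m y; exact: gf.
- by congr (_, _); apply: IHn => m y; exact: gf.
Qed.

(** Each term is a finite product of evaluations of [V], hence exact in [V]. *)
Lemma Kmap_exact n q V W U (f : FIHom V W) (g : FIHom W U) :
  (forall m x, hmap g m x = 0 -> exists y, hmap f m y = x) ->
  forall x, Kmap n q g x = 0 -> exists y, Kmap n q f y = x.
Proof.
elim: n q V W U f g => [|n IHn] [|q] V W U f g gf x /=.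
- exact: gf.
- by exists x.
- by apply: (IHn _ _ _ _ (FIshift_hom f) (FIshift_hom g)) => m; exact: gf.
- case: x => x y [x0 y0].
  have [x' <-] := IHn _ _ _ _ (FIshift_hom f) (FIshift_hom g) (fun m => gf m.+1) x x0.
  by have [y' <-] := IHn _ _ _ _ f _ gf y y0; exists (x', y').
Qed.

Lemma Kmap_surj n q V W (f : FIHom V W) :
  (forall m x, exists y, hmap f m y = x) ->
  forall x, exists y, Kmap n q f y = x.
Proof.
elim: n q V W f => [|n IHn] [|q] V W f sf x /=.
- exact: sf.
- by exists x.
- by apply: (IHn _ _ _ (FIshift_hom f)) => m; exact: sf.
- case: x => x y.
  have [x' <-] := IHn _ _ _ (FIshift_hom f) (fun m => sf m.+1) x.
  by have [y' <-] := IHn _ _ _ f sf y; exists (x', y').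
Qed.

(** The mapping cone differential: the complex of [V] sits one degree higher, hence the sign, which
    makes the two [to_shift] terms of its square cancel. *)
Fixpoint Kd n q V {struct n} : K n q.+1 V -> K n q V :=
  match n, q return K n q.+1 V -> K n q V with
  | 0, _ => fun=> 0
  | n.+1, 0 => fun x => Kd x.1 + Kmap n 0 (to_shift V) x.2
  | n.+1, q.+1 => fun x => (Kd x.1 + Kmap n q.+1 (to_shift V) x.2, - Kd x.2)
  end.
Arguments Kd n q V : clear implicits.

Lemma comb_add (M : lmodType R) (a : R) (u u' v v' : M) :
  (a *: u + v) + (a *: u' + v') = a *: (u + u') + (v + v').
Proof. by rewrite scalerDr addrACA. Qed.

Lemma Kd_linear n q V : linear (Kd n q V).
Proof.
elim: n q V => [|n IHn] [|q] V a x y /=.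
- by rewrite scaler0 addr0.
- by rewrite scaler0 addr0.
- by rewrite IHn linearP; exact: comb_add.
- rewrite !IHn linearP; congr (_, _); first exact: comb_add.
  by rewrite /= opprD scalerN.
Qed.

HB.instance Definition _ n q V :=
  GRing.isLinear.Build R (K n q.+1 V) (K n q V) *:%R (Kd n q V) (@Kd_linear n q V).

Lemma Kd_natural n q V W (phi : FIHom V W) x :
  Kd n q W (Kmap n q.+1 phi x) = Kmap n q phi (Kd n q V x).
Proof.
have nat m y : hmap (to_shift W) m (hmap phi m y)
    = hmap (FIshift_hom phi) m (hmap (to_shift V) m y).
  by rewrite /= hnat.
elim: n q V W phi x nat => [|n IHn] [|q] V W phi x nat.
- by rewrite linear0.
- by rewrite linear0.
- rewrite /= IHn; last by move=> m y; rewrite /= hnat.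
  by rewrite [RHS]linearD; congr (_ + _); apply: Kmap_square.
- rewrite /= !IHn //; last by move=> m y; rewrite /= hnat.
  rewrite linearN; congr (_, _).
  by rewrite [RHS]linearD; congr (_ + _); apply: Kmap_square.
Qed.

Lemma Kdd n q V x : Kd n q V (Kd n q.+1 V x) = 0.
Proof.
elim: n q V x => [|n IHn] [|q] V x //=.
- by rewrite linearD /= IHn add0r Kd_natural linearN /= subrr.
- congr (_, _); last by rewrite /= linearN /= IHn !oppr0.
  by rewrite linearD /= IHn add0r Kd_natural linearN /= subrr.
Qed.

(* A cycle [(u, v)] satisfies [d u + iota v = 0], so the retraction [r] of
   [iota] gives [v = - d (r u)]; subtracting the boundary of [(0, r u)] leaves
   the cycle [u - iota (r u)] of the shifted module. *)
Lemma sharp_Kd_exact n q V (s : sharp V) x :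
  Kd n q V x = 0 -> exists y, Kd n q.+1 V y = x.
Proof.
elim: n q V s x => [|n IHn] q V s x; first by exists 0; apply/rowP => -[].
case: x => u v duv.
pose r := sharp_retract s; pose w := Kmap n q.+1 r u.
have {}duv : Kd n q (FIshift V) u + Kmap n q (to_shift V) v = 0.
  by case: q u v duv w => [|q] u v //= [].
have rK q' y : Kmap n q' r (Kmap n q' (to_shift V) y) = y.
  by apply: Kmap_retract => m z; exact: sharp_retractK.
have dw : - Kd n q V w = v.
  have := congr1 (Kmap n q r) duv.
  rewrite linearD linear0 /= rK -Kd_natural -/w => /eqP.
  by rewrite addrC addr_eq0 => /eqP ->.
have [y dy] : exists y, Kd n q.+1 (FIshift V) y = u - Kmap n q.+1 (to_shift V) w.
  apply: (IHn _ _ (sharp_shift s)).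
  by rewrite linearB /= Kd_natural -linearN dw.
by exists (y, w); rewrite /= dy dw subrK.
Qed.

End Koszul.
Arguments Kd {R} n q V.
Arguments Kmap {R} n q {V W} phi.

(** * The zeroth Koszul homology *)

Lemma inj_factor_shift m n (a : Inj m n.+1) :
  (forall i, val a i != ord0) -> exists b, a = Defs.inj_comp (inj_shift n) b.
Proof.
move=> a0.
have /fin_all_exists[b bP] i : exists j, val a i = lift ord0 j.
  by case: (unliftP ord0 (val a i)) (a0 i) => [j ->|-> /eqP//]; exists j.
have Ib : injective b.
  by move=> x y bxy; apply: (@val_injective _ _ a); rewrite !bP bxy.
exists (mk_inj Ib); apply/inj_eqP => i; by rewrite bP /= !ffunE.
Qed.

(** The transposition [t] moves [i] to the first place; after it, the first point is fixed and, by
    injectivity, no other point is sent there, so a lifted injection remains. *)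
Lemma inj_factor_lift m n (a : Inj m.+1 n.+1) i : val a i = ord0 ->
  exists (b : Inj m n) (t : Inj m.+1 m.+1), a = Defs.inj_comp (inj_lift b) t.
Proof.
move=> ai; pose t := mk_inj (@perm_inj _ (tperm ord0 i)).
have /fin_all_exists[b bP] j : exists k, val a (tperm ord0 i (lift ord0 j)) = lift ord0 k.
  case: (unliftP ord0 (val a (tperm ord0 i (lift ord0 j)))) => [k ->|]; first by exists k.
  rewrite -ai => /(@val_injective _ _ a) /(canRL (tpermK _ _)).
  by rewrite tpermR => /eqP; rewrite eq_sym (negPf (neq_lift _ _)).
have Ib : injective b.
  move=> x y bxy; apply/(@lift_inj _ ord0)/(@perm_inj _ (tperm ord0 i)).
  by apply: (@val_injective _ _ a); rewrite !bP bxy.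
exists (mk_inj Ib), t; apply/inj_eqP => j; rewrite /= !ffunE /=.
rewrite -{1}(tpermK ord0 i j).
case: (unliftP ord0 (tperm ord0 i j)) => [k ->|->].
  by rewrite bP lift0_lift /= ffunE.
by rewrite tpermL lift0_ord0.
Qed.

Section KoszulHomology.
Variable R : comPzRingType.
Implicit Types V W : FIMod R.

Lemma projective_Kd_exact n q V : projective V -> forall x,
  Kd n q V x = 0 -> exists y, Kd n q.+1 V y = x.
Proof.
move=> /projective_retract[i iK] x dx.
have [y dy] : exists y, Kd n q.+1 _ y = Kmap n q.+1 i x.
  apply: (sharp_Kd_exact (freeFI_sharp R (fmod V))).
  by rewrite Kd_natural dx linear0.
exists (Kmap n q.+2 (free_cover V) y).
by rewrite Kd_natural dy; apply: Kmap_retract iK _.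
Qed.

(** The identity in disguise: the two modules are convertible for each numeral [n], but not for a
    variable one. *)
Fixpoint Kin n V {struct n} : fmod V n -> K n 0 V :=
  match n return fmod V n -> K n 0 V with
  | 0 => id
  | n.+1 => @Kin n (FIshift V)
  end.
Arguments Kin n V : clear implicits.

Lemma Kin_linear n V : linear (Kin n V).
Proof. by elim: n V => [|n IHn] V //; exact: (IHn (FIshift V)). Qed.

HB.instance Definition _ n V :=
  GRing.isLinear.Build R (fmod V n) (K n 0 V) *:%R (Kin n V) (@Kin_linear n V).

Lemma Kin_inj n V : injective (Kin n V).
Proof. by elim: n V => [|n IHn] V //; exact: (IHn (FIshift V)). Qed.

Lemma Kin_surj n V y : exists x, Kin n V x = y.
Proof.
elim: n V y => [|n IHn] V y; first by exists y.
exact: (IHn (FIshift V)).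
Qed.

Lemma Kin_natural n V W (phi : FIHom V W) x :
  Kmap n 0 phi (Kin n V x) = Kin n W (hmap phi n x).
Proof.
elim: n V W phi x => [|n IHn] V W phi x //.
exact: (IHn _ _ (FIshift_hom phi)).
Qed.

Lemma inJ_fmap V m n (a : Inj m n) z : (m < n)%N -> inJ (fmap V a z).
Proof. by move=> mn; apply: inspan_gen; exists m, a, z. Qed.

Lemma inJ_shift V n x : inJ (V := FIshift V) (n := n) x -> inJ (V := V) (n := n.+1) x.
Proof.
elim=> {x} [|y [m [a [z [mn ->]]]]|x y _ Jx _ Jy|a x _ Jx].
- exact: inspan0.
- exact: inJ_fmap.
- exact: inspanD.
- exact: inspanZ.
Qed.

(** A boundary has two parts: the image under [inj_shift] is in [J V] at once, and the boundary for
    the shifted module is in [J V] by induction. *)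
Lemma im_Kd_inJ n V x y : Kd n 0 V y = Kin n V x -> inJ x.
Proof.
elim: n V x y => [|n IHn] V x y; first by move=> /= <-; exact: inspan0.
case: y => y1 y2 /=; have [z <-] := Kin_surj y2.
rewrite Kin_natural; set w := hmap _ _ _ => yx.
have /IHn/inJ_shift Jxw : Kd n 0 _ y1 = Kin n (FIshift V) (x - w).
  by rewrite linearB /= -yx addrK.
rewrite -(subrK w x); apply: inspanD => //.
exact: inJ_fmap.
Qed.

(** For a generator [fmap V a z]: if [a] misses the first point it factors through [inj_shift],
    giving the second summand of the cone; otherwise it is a lift up to a permutation, and induction
    applies to the shifted module. *)
Lemma inJ_im_Kd n V x : inJ x -> exists y, Kd n 0 V y = Kin n V x.
Proof.
elim=> {x} [|x [m [a [z [mn ->]]]]|x y _ [x' dx] _ [y' dy]|a x _ [x' dx]]; last 2 first.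
- by exists (x' + y'); rewrite linearD /= dx dy -linearD.
- by exists (a *: x'); rewrite linearZ /= dx -linearZ.
- by exists 0; rewrite !linear0.
clear x; elim: n V m a z mn => // n IHn V m a z mn.
have [/existsP[i /eqP ai]|] := boolP [exists i, val a i == ord0]; last first.
  rewrite negb_exists => /forallP/inj_factor_shift[b ->].
  exists (0, Kin n V (fmap V b z)).
  by rewrite /= linear0 add0r Kin_natural fmap_comp.
case: m a z mn i ai => [|m] a z mn i ai; first by case: i {ai}.
have [b [t ->]] := inj_factor_lift ai.
have [y dy] := IHn (FIshift V) m b (fmap V t z) mn.
by exists (y, 0); rewrite /= linear0 addr0 dy /= fmap_comp.
Qed.

End KoszulHomology.
Arguments Kin {R} n V.

(** * Counting generators *)

Section Span.
Variables (R : comPzRingType) (M : lmodType R).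

Lemma inspan_sum (s : seq M) x : inspan (fun y => y \in s) x ->
  exists c : 'I_(size s) -> R, x = \sum_i c i *: s`_i.
Proof.
elim=> {x} [|x xs|x y _ [c ->] _ [c' ->]|a x _ [c ->]].
- by exists (fun=> 0); rewrite big1 // => i _; rewrite scale0r.
- have ixs : (index x s < size s)%N by rewrite index_mem.
  exists (fun i => (i == Ordinal ixs)%:R).
  rewrite (bigD1 (Ordinal ixs)) //= eqxx scale1r nth_index // big1 ?addr0 //.
  by move=> i /negPf ->; rewrite scale0r.
- exists (fun i => c i + c' i); rewrite -big_split.
  by apply: eq_bigr => i _; rewrite scalerDl.
- exists (fun i => a * c i); rewrite scaler_sumr.
  by apply: eq_bigr => i _; rewrite scalerA.
Qed.

(* The nonzero cyclic quotient is [M / span P], generated by the class of [x]. *)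
Lemma cyclic_quotient (s : seq M) : (forall y, inspan (fun z => z \in s) y) ->
  (exists y : M, y != 0) ->
  exists (x : M) (P : M -> Prop),
    ~ inspan P x /\ forall y, exists a, inspan P (y - a *: x).
Proof.
move=> span_s [y0 y0n0]; elim: s span_s => [|x s IHs] span_s.
  have [c] := inspan_sum (span_s y0); rewrite big_ord0 => /eqP.
  by rewrite (negPf y0n0).
(* A redundant head is dropped; a head that is not redundant generates a nonzero quotient modulo the
   span of the tail. *)
have [/IHs //|/not_all_ex_not[y ny]] := classic (forall y, inspan (fun z => z \in s) y).
exists x, (fun z => z \in s).
have decomp z : exists a, inspan (fun z => z \in s) (z - a *: x).
  elim: (span_s z) => {z} [|z|z t _ [a za] _ [b tb]|b z _ [a za]].
  - by exists 0; rewrite scale0r subr0; exact: inspan0.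
  - rewrite in_cons => /predU1P[-> | zs].
      by exists 1; rewrite scale1r subrr; exact: inspan0.
    by exists 0; rewrite scale0r subr0; exact: inspan_gen.
  - by exists (a + b); rewrite scalerDl opprD addrACA; exact: inspanD.
  - by exists (b * a); rewrite -scalerA -scalerBr; exact: inspanZ.
split=> // xs; case: ny; have [a] := decomp y.
by rewrite -{2}(subrK (a *: x) y) => ya; apply: inspanD (inspanZ _ _).
Qed.

End Span.

Section Generation.
Variable R : comPzRingType.
Implicit Types X Y M : lmodType R.

Definition gen_by X N :=
  exists e : 'I_N -> X, forall x, exists c : 'I_N -> R, x = \sum_i c i *: e i.

Lemma gen_by_surj X Y (f : {linear X -> Y}) N :
  (forall y, exists x, f x = y) -> gen_by X N -> gen_by Y N.
Proof.
move=> sf [e eP]; exists (f \o e) => y; have [x <-] := sf y.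
have [c ->] := eP x; exists c; rewrite linear_sum.
by apply: eq_bigr => i _; rewrite linearZ.
Qed.

Lemma gen_by_prod X Y a b : gen_by X a -> gen_by Y b -> gen_by (X * Y)%type (a + b).
Proof.
move=> [e eP] [f fP].
exists (fun i => match split i with inl j => (e j, 0) | inr j => (0, f j) end).
case=> x y; have [c ->] := eP x; have [d ->] := fP y.
exists (fun i => match split i with inl j => c j | inr j => d j end).
rewrite big_split_ord; apply: injective_projections => /=.
  rewrite ?raddfD !raddf_sum /= [X in _ + X]big1 ?addr0 => [|i _].
    by apply: eq_bigr => i _; rewrite (unsplitK (inl i)).
  by rewrite (unsplitK (inr i)) /= scaler0.
rewrite ?raddfD !raddf_sum /= [X in X + _]big1 ?add0r => [|i _].
  by apply: eq_bigr => i _; rewrite (unsplitK (inr i)).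
by rewrite (unsplitK (inl i)) /= scaler0.
Qed.

(** Dual families detecting [c] copies of [M] inside [X]: [e i] carries [x] in the [i]-th copy and
    [phi j] reads the [j]-th one. No isomorphism with a power of [M] has to be built. *)
Definition coords X M (x : M) c :=
  exists (e : 'I_c -> X) (phi : 'I_c -> {linear X -> M}),
    forall i j, phi j (e i) = (i == j)%:R *: x.

Lemma coords0 X M (x : M) : coords X x 0.
Proof. by exists (fun=> 0), (fun=> \0) => -[]. Qed.

Lemma coords1 M (x : M) : coords M x 1.
Proof. by exists (fun=> x), (fun=> idfun) => i j; rewrite !ord1 eqxx scale1r. Qed.

Lemma coords_prod X Y M (x : M) a b :
  coords X x a -> coords Y x b -> coords (X * Y)%type x (a + b).
Proof.
move=> [e [phi eP]] [f [psi fP]].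
exists (fun i => match split i with inl j => (e j, 0) | inr j => (0, f j) end).
exists (fun i => match split i with
  | inl j => (phi j \o fst)%FUN : {linear (X * Y)%type -> M}
  | inr j => (psi j \o snd)%FUN : {linear (X * Y)%type -> M} end).
move=> i j; rewrite -(can_eq (@splitK a b) i j).
by case: (split i) (split j) => [i'|i'] [j'|j'] /=;
  rewrite ?eP ?fP // linear0 scale0r.
Qed.

(** The scalars taking [x] into the span of [P] form an ideal, and a determinant is a polynomial in
    the entries: a matrix congruent to the identity modulo this ideal has determinant congruent to
    [1]. *)
Lemma det_congr M (P : M -> Prop) (x : M) c (D : 'M[R]_c) :
  (forall i j, inspan P (D i j *: x - (i == j)%:R *: x)) ->
  inspan P (\det D *: x - x).
Proof.
move=> DP; pose eqm (a b : R) := inspan P (a *: x - b *: x).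
have eqmD a a' b b' : eqm a b -> eqm a' b' -> eqm (a + a') (b + b').
  by move=> ab ab'; rewrite /eqm !scalerDl opprD addrACA; exact: inspanD.
have eqmM a a' b b' : eqm a b -> eqm a' b' -> eqm (a * a') (b * b').
  move=> ab ab'; rewrite /eqm.
  have -> : (a * a') *: x - (b * b') *: x
      = a' *: (a *: x - b *: x) + b *: (a' *: x - b' *: x).
    by rewrite !scalerBr !scalerA addrA [a' * b]mulrC subrK mulrC.
  exact: inspanD (inspanZ _ _) (inspanZ _ _).
have eqmr a : eqm a a by rewrite /eqm subrr; exact: inspan0.
suff : eqm (\det D) (\det (1%:M : 'M[R]_c)) by rewrite /eqm det1 scale1r.
rewrite /determinant; elim/big_ind2: _ => [|a b a' b'|s _] //; first exact: eqmD.
apply: (eqmM) => //; elim/big_ind2: _ => [|a b a' b'|i _] //; first exact: eqmM.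
by rewrite mxE; exact: DP.
Qed.

(** Padding with zeros makes both factors square, the first with a zero column. *)
Lemma det_thin m k (B : 'M[R]_(m + k.+1, m)) (C : 'M[R]_(m, m + k.+1)) :
  \det (B *m C) = 0.
Proof.
have -> : B *m C = row_mx B (0 : 'M_(_, k.+1)) *m col_mx C 0.
  by rewrite mul_row_col mul0mx addr0.
rewrite det_mulmx (expand_det_col _ (rshift m ord0)) big1 ?mul0r // => i _.
by rewrite row_mxEr mxE mul0r.
Qed.

(* [phi] reads a system of [c] generators off a system of [N], so that the
   identity matrix of size [c] becomes, modulo [P], a product of matrices
   through [R^N]; such a product has determinant [0] when [N < c]. *)
Lemma coords_gen_by X M (P : M -> Prop) (x : M) c N :
  (forall y, exists a, inspan P (y - a *: x)) ->
  coords X x c -> gen_by X N -> (N < c)%N -> inspan P x.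
Proof.
move=> decomp [e [phi eP]] [f fP] /subnKC; move: (c - _)%N => k ck.
rewrite addSnnS in ck; case: _ / ck e phi eP => e phi eP.
have /fin_all_exists[B BP] i := fP (e i).
have ex_C l : exists cl : 'I_(N + k.+1) -> R,
    forall j, inspan P (phi j (f l) - cl j *: x).
  exact: fin_all_exists (fun j => decomp (phi j (f l))).
have [C CP] := fin_all_exists ex_C.
have := @det_congr M P x _ (\matrix_(i, l) B i l *m \matrix_(l, j) C l j).
rewrite det_thin scale0r sub0r => Px.
rewrite -[x]opprK -scaleN1r; apply: inspanZ; apply: Px => i j.
rewrite -eP BP linear_sum mxE scaler_suml -sumrB.
apply: (big_ind (inspan P)) => [||l _]; [exact: inspan0 | exact: inspanD |].
rewrite !mxE linearZ -scalerA -scalerBr -opprB scalerN -scaleNr /=.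
exact: inspanZ (CP _ _).
Qed.
End Generation.

Section KoszulRank.
Variable R : comPzRingType.
Implicit Types V : FIMod R.

(** Pascal's rule mirrors the splitting of [K]. Writing [n = k + q] instead of subtracting leaves
    nothing to assume when [q > n], where the term is zero. *)
Lemma K_gen n q V g : (forall k, n = k + q -> gen_by (fmod V k) g)%N ->
  gen_by (K n q V) ('C(n, q) * g).
Proof.
elim: n q V => [|n IHn] [|q] V genV /=.
- by rewrite bin0 mul1n; exact: genV.
- by exists (fun=> 0) => x; exists (fun=> 0); apply/rowP => -[].
- rewrite bin0 -(bin0 n); apply: IHn => k nk; apply: (genV k.+1).
  by rewrite nk.
- rewrite binS mulnDl; apply: gen_by_prod; apply: IHn => k nk.
    by apply: (genV k.+1); rewrite nk.
  by apply: genV; rewrite nk addnS.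
Qed.

Lemma K_coords n q V k (x : fmod V k) : (n = k + q)%N ->
  coords (K n q V) x 'C(n, q).
Proof.
elim: n q V k x => [|n IHn] [|q] V k x /=.
- by case: k x => // x _; rewrite bin0; exact: coords1.
- by rewrite addnS.
- case: k x => // k x [nk]; rewrite bin0 -(bin0 n).
  exact: (IHn 0 (FIshift V) k x).
- rewrite addnS binS => -[nk]; apply: coords_prod; last exact: IHn.
  case: k x nk => [|k] x nk; first by rewrite bin_small ?nk //; exact: coords0.
  by apply: (IHn q.+1 (FIshift V) k x); rewrite addnS.
Qed.

Lemma K_zero n q V : (forall k, n = (k + q)%N -> forall x : fmod V k, x = 0) ->
  forall x : K n q V, x = 0.
Proof.
move=> V0 x; have [|e eP] := @K_gen n q V 0.
  by move=> k nk; exists (fun=> 0) => y; exists (fun=> 0); rewrite big_ord0; exact: V0.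
by move: e eP; rewrite muln0 => e eP; have [c ->] := eP x; rewrite big_ord0.
Qed.
End KoszulRank.

(** * The double complex *)

Section DoubleComplex.
(** Column [0] will hold [V], column [p.+1] the projective [P_p], and [q] is the Koszul degree. The
    rows [dh] are exact everywhere; the columns [dv] are exact in positive degree except column [0],
    whose homology is the Koszul homology of [V]. Squares commute, so the zigzags carry no signs. *)
Variables (R : comPzRingType) (D : nat -> nat -> lmodType R).
Variables (dh : forall p q, {linear D p.+1 q -> D p q}).
Variables (dv : forall p q, {linear D p q.+1 -> D p q}).
Hypothesis dhv : forall p q x, dv p q (dh p q.+1 x) = dh p q (dv p.+1 q x).
Hypothesis dhh : forall p q x, dh p q (dh p.+1 q x) = 0.
Hypothesis dvv : forall p q x, dv p q (dv p q.+1 x) = 0.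
Hypothesis dh_surj : forall q x, exists y, dh 0 q y = x.
Hypothesis dh_exact : forall p q x, dh p q x = 0 -> exists y, dh p.+1 q y = x.
Hypothesis dv_exact : forall p q x,
  dv p.+1 q x = 0 -> exists y, dv p.+1 q.+1 y = x.

(** A staircase towards column [0]: [dh y] is a vertical cycle because [dh (dh x) = 0], so it bounds
    some [y'] one column nearer and one degree higher. In column [0] the term vanishes, and the
    decomposition is carried back. *)
Lemma zigzag_vanish p q (x : D p.+2 q) y :
  (forall z : D 0 (p + q).+1, z = 0) -> dh p.+1 q x = dv p.+1 q y ->
  exists z w, x = dh p.+2 q z + dv p.+2 q w.
Proof.
move=> D0 xy.
(* If [y'] decomposes through [z] and [w], then [x' - dv z] is a horizontal cycle, hence a
   horizontal boundary. *)
have lift p' q' (x' : D p'.+2 q') y' z w : dh p'.+1 q' x' = dv p'.+1 q' y' ->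
    y' = dh p'.+1 q'.+1 z + dv p'.+1 q'.+1 w ->
    exists z' w', x' = dh p'.+2 q' z' + dv p'.+2 q' w'.
  move=> x'y' y'E; have [|t tE] := @dh_exact p'.+1 q' (x' - dv _ _ z).
    by rewrite linearB x'y' y'E linearD /= dvv addr0 dhv subrr.
  by exists t, z; rewrite tE subrK.
elim: p q x y D0 xy => [|p IHp] q x y D0 xy.
  have [|z zy] := @dh_exact 0 q.+1 y; first exact: D0.
  by apply: (lift _ _ _ _ z 0 xy); rewrite zy linear0 addr0.
have [|y' yy'] := @dv_exact p q (dh p.+1 q.+1 y); first by rewrite dhv -xy dhh.
have [|z [w yE]] := IHp _ y y' _ (esym yy'); first by rewrite addnS.
exact: lift xy yE.
Qed.

(** The opposite staircase: lift [w] along [dh]; the vertical image of the lift is a horizontal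
    cycle, so it lifts again, down to degree [0]. If the last element were [good], each earlier one
    would be by [step], and [w] would be a vertical boundary. *)
Lemma zigzag_lift q (w : D 0 q.+1) :
  dv 0 q w = 0 -> (forall z, dv 0 q.+1 z <> w) ->
  exists x : D q.+2 0, (exists y, dh q.+1 0 x = dv q.+1 0 y) /\
    forall z t, x <> dh q.+2 0 z + dv q.+2 0 t.
Proof.
pose good p q' (x : D p q') := exists z t, x = dh p q' z + dv p q' t.
have step p q' (x : D p.+1 q'.+1) (x' : D p.+2 q') :
    dh p.+1 q' x' = dv p.+1 q' x -> good _ _ x' -> good _ _ x.
  move=> x'x [y [z x'E]].
  have [|t tE] := @dv_exact p q' (x - dh _ _ z).
    by rewrite linearB -x'x x'E linearD /= dhh add0r dhv subrr.
  by exists z, t; rewrite tE addrC subrK.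
(* The column reached is a variable [N] with an equation, which avoids casts between propositionally
   equal indices. *)
have climb q' : forall p (x : D p.+1 q'.+1) N, N = (q' + p).+1 ->
    dh p q' (dv p.+1 q' x) = 0 ->
    exists x0 : D N.+1 0, (exists y, dh N 0 x0 = dv N 0 y) /\ (good _ _ x0 -> good _ _ x).
  elim: q' => [|q' IHq] p x N -> /dh_exact[x' x'x].
    by exists x'; split; [exists x|exact: step].
  have [||x0 [x0P x0x']] := IHq p.+1 x' (q' + p.+1).+1 => //.
    by rewrite -dhv x'x dvv.
  rewrite addSnnS; exists x0; split=> // /x0x'; exact: step.
move=> dw nw; have [x xw] := dh_surj w.
have [||x0 [x0P x0x]] := @climb q 0 x q.+1; first by rewrite addn0.
  by rewrite -dhv xw.
exists x0; split=> // z t x0E.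
have [|y [u xE]] := x0x; first by exists z, t.
by apply: (nw (dh 0 q.+2 u)); rewrite -xw xE linearD /= dhh add0r dhv.
Qed.

End DoubleComplex.

(** * FI-homology and regularity *)

Section Regularity.
Variable R : comPzRingType.

Lemma fin_gen_level (V : FIMod R) : fin_gen V -> forall k,
  exists s : seq (fmod V k), forall x, inspan (fun y => y \in s) x.
Proof.
move=> [s sP] k.
exists [seq fmap V a (tagged v) | v <- s, a <- enum {: Inj (tag v) k}] => x.
elim: (sP k x) => {x} [|x [v [vs [a ->]]]|x y _ Jx _ Jy|a x _ Jx].
- exact: inspan0.
- apply: inspan_gen; apply: (allpairs_f_dep (fun v a => fmap V a (tagged v))) => //.
  by rewrite mem_enum.
- exact: inspanD.
- exact: inspanZ.
Qed.

Variables (V : FIMod R) (res : Resolution V).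

(** Prepending [V] shifts indices: [FIH_nonzero res a] concerns the homology of index [a.+1], at
    [rP res a.+1], that is, at column [a.+2]. *)
Definition aug p : FIMod R := if p is p'.+1 then rP res p' else V.

Definition aug_hom p : FIHom (aug p.+1) (aug p) :=
  if p is p'.+1 then rd res p' else reps res.

Lemma aug_comp0 p n x : hmap (aug_hom p) n (hmap (aug_hom p.+1) n x) = 0.
Proof. by case: p x => [|p] x; [exact: rcomp0|exact: rcomp]. Qed.

Lemma aug_exact p n x : hmap (aug_hom p) n x = 0 ->
  exists y, hmap (aug_hom p.+1) n y = x.
Proof. by case: p x => [|p] x; [exact: rexact0|exact: rexact]. Qed.

Let D n p q := K n q (aug p).
Let dh n p q : {linear D n p.+1 q -> D n p q} := Kmap n q (aug_hom p).
Let dv n p q : {linear D n p q.+1 -> D n p q} := Kd n q (aug p).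

(** Through [Kin], lying in [J] means being a Koszul boundary; here and in [boundary_dv], conditions
    modulo [J] become conditions on the edge [q = 0] of the double complex. *)
Lemma cycle_dv n p (x : fmod (aug p.+1) n) :
  inJ (hmap (aug_hom p) n x) <-> exists y, dh n p 0 (Kin n _ x) = dv n p 0 y.
Proof.
rewrite /dh /= Kin_natural; split=> [/inJ_im_Kd[y <-]|[y dy]]; first by exists y.
exact: im_Kd_inJ (esym dy).
Qed.

Lemma boundary_dv n p (x : fmod (aug p.+1) n) :
  (exists (y : fmod (aug p.+2) n) z,
     inJ z /\ x = hmap (aug_hom p.+1) n y + z) <->
  exists y z, Kin n _ x = dh n p.+1 0 y + dv n p.+1 0 z.
Proof.
split=> [[y [z [/inJ_im_Kd[t dt] ->]]]|[y [z xE]]].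
  exists (Kin n _ y), t; rewrite linearD /= Kin_natural; congr (_ + _).
  exact/esym.
have [y' yE] := Kin_surj y; have [z' zE] := Kin_surj (dv n p.+1 0 z).
exists y', z'; split; first by apply: im_Kd_inJ (esym zE).
apply: (@Kin_inj _ n (aug p.+1)).
by rewrite xE -yE -zE /dh /= Kin_natural linearD.
Qed.

Let dhv n p q x : dv n p q (dh n p q.+1 x) = dh n p q (dv n p.+1 q x).
Proof. exact: Kd_natural. Qed.

Let dhh n p q x : dh n p q (dh n p.+1 q x) = 0.
Proof. by apply: Kmap_comp0 => m y; exact: aug_comp0. Qed.

Let dvv n p q x : dv n p q (dv n p q.+1 x) = 0.
Proof. exact: Kdd. Qed.

Let dh_surj n q x : exists y, dh n 0 q y = x.
Proof. by apply: Kmap_surj => m y; exact: reps_surj. Qed.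

Let dh_exact n p q x : dh n p q x = 0 -> exists y, dh n p.+1 q y = x.
Proof. by apply: Kmap_exact => m y; exact: aug_exact. Qed.

Let dv_exact n p q x : dv n p.+1 q x = 0 -> exists y, dv n p.+1 q.+1 y = x.
Proof. by apply: projective_Kd_exact; exact: rproj. Qed.

Lemma FIH_vanish a n :
  (forall k, n = (k + a.+1)%N -> forall x : fmod V k, x = 0) ->
  ~ FIH_nonzero res a n.
Proof.
move=> V0 [x [/(@cycle_dv n a.+1 x)[y dxy] nb]]; apply: nb.
apply/(@boundary_dv n a.+1 x).
apply: (zigzag_vanish (@dhv n) (@dhh n) (@dvv n) (@dh_exact n) (@dv_exact n)) dxy.
by move=> z; rewrite addn0 in z *; exact: K_zero.
Qed.

Lemma FIH_nonvanish a n (w : K n a.+1 V) : Kd n a V w = 0 ->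
  (forall z, Kd n a.+1 V z <> w) -> FIH_nonzero res a n.
Proof.
move=> dw nw.
have [x0 [x0P nx0]] := zigzag_lift (@dhv n) (@dhh n) (@dvv n) (@dh_surj n)
  (@dh_exact n) (@dv_exact n) dw nw.
have [x xE] := Kin_surj x0; exists x; split.
  by apply/(@cycle_dv n a.+1 x); rewrite xE.
move/(@boundary_dv n a.+1 x) => [y [z]].
by rewrite xE; exact: nx0.
Qed.

Lemma top_homology d : fin_gen V -> deg_is V (Some d) ->
  exists a, FIH_nonzero res a (d + a.+1).
Proof.
move=> fgV [Vd V0].
have [s s_span] := fin_gen_level fgV d.
have [x [P [nPx decomp]]] := cyclic_quotient s_span Vd.
(* A number of generators for [V_(d-1)]; for [d = 0] there is no such module and [g = 0] serves. *)
have [g genV] : exists g, forall k, k.+1 = d -> gen_by (fmod V k) g.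
  case: (d) => [|k]; first by exists 0%N.
  have [t t_span] := fin_gen_level fgV k.
  exists (size t) => _ [->]; exists (nth 0 t) => y; exact: inspan_sum.
(* As [(a + 2) * 'C(d + a + 1, a + 2) = d * 'C(d + a + 1, a + 1)], this choice gives ['C(d + a + 1,
   a + 2) * g < 'C(d + a + 1, a + 1)]: too few generators for a surjection. *)
pose a := (d * g)%N; exists a; apply: NNPP => nH; apply: nPx.
(* Every [w] is a cycle, since the next term is made of copies of [V_(d+1)], which is zero; without
   homology it is then a boundary. *)
have dv_surj w : exists z, Kd (d + a.+1) a.+1 V z = w.
  apply: NNPP => nz; apply: nH; apply: (@FIH_nonvanish _ _ w) => [|z zw].
    apply: K_zero => k dk y; apply: V0; lia.
  by apply: nz; exists z.
have genK : gen_by (K (d + a.+1) a.+2 V) ('C(d + a.+1, a.+2) * g).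
  by apply: K_gen => k dk; apply: genV; lia.
apply: coords_gen_by decomp (K_coords x erefl) (gen_by_surj dv_surj genK) _.
have C_gt0 : (0 < 'C(d + a.+1, a.+1))%N by rewrite bin_gt0 leq_addl.
rewrite -(ltn_pmul2l (ltn0Sn a.+1)) mulnA mul_bin_left addnK mulnAC -/a.
by rewrite ltn_pmul2r.
Qed.

End Regularity.

Theorem theorem1p2 (R : comPzRingType) (V : FIMod R) (d : option nat) :
  fin_gen V -> deg_is V d ->
  inhabited (Resolution V) /\
  forall res : Resolution V, reg_is res (omap (fun k : nat => (k%:Z)%R) d).
Proof.
move=> fgV; case: d => [d|] degV; split; try exact: inhabits (free_resolution V).
  move=> res; split=> [a n H|c adm].
    have [_ V0] := degV; rewrite leNgt; apply/negP => dn.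
    case: (FIH_vanish _ H) => k nk x; apply: V0; lia.
  have [a /adm] := top_homology res fgV degV; lia.
(* For [V = 0] all homology vanishes, so every integer is admissible. *)
move=> res b; exists b; split=> // a n H.
by case: (FIH_vanish _ H) => k _; exact: degV.
Qed.
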